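(* Let $(\mathcal{X},d_{\mathcal{X}})$ be a metric space, $(\mathcal{X},\mathcal{A},\mu)$ a $\sigma$-finite measure space (where $\mathcal{A}$ can, but does not have to, be the Borel $\sigma$-algebra on the metric space $\mathcal{X}$), $1<p,q<\infty$ with $1/p+1/q=1$, and $k:\mathcal{X}\times\mathcal{X}\to\mathbb{K}$ a measurable kernel such that $H_k$ is separable and $$\|k\|_{L^p}=\left(\int (k(x,x))^{\frac{p}{2}}\,\mathrm{d}\mu(x)\right)^{\frac1p}<\infty.$$ Assume that there exist $\alpha\in\mathbb{R}_{>0}$ and $L_\alpha\in\mathcal{L}^p(\mathcal{X},\mathcal{A},\mu,\mathbb{R}_{\geq0})$ such that for $\mu$-almost all $x\in\mathcal{X}$ the function $k(\cdot,x)$ is $\alpha$-H\''older continuous with H\''older constant $L_\alpha(x)$. Under these conditions, $$S_k:L^q(\mathcal{X},\mathcal{A},\mu,\mathbb{K})\to H_k,\quad (S_kg)(x)=\int_{\mathcal{X}}k(x,x')g(x')\,\mathrm{d}\mu(x')$$ is a well-defined, bounded linear operator, and for all $g\in L^q(\mathcal{X},\mathcal{A},\mu,\mathbb{K})$, the function $f=S_kg\in H_k$ is $\alpha$-H\''older continuous with H\''older constant $\|L_\alpha\|_{\mathcal{L}^p}\|g\|_{L^q}$. Finally, all functions in $H_k$ are $p$-integrable (i.e. $\int_{\mathcal{X}}|f(x)|^p\,\mathrm{d}\mu(x)<\infty$ for all $f\in H_k$), and if the inclusion $\mathrm{id}:H_k\to L^p(\mathcal{X},\mathcal{A},\mu,\mathbb{K})$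 is injective, then the image of $S_k$ is dense in $H_k$.
   Context: $\mathbb{K}$ denotes $\mathbb{R}$ or $\mathbb{C}$. A kernel on $\mathcal{X}$ is a positive semidefinite function $k:\mathcal{X}\times\mathcal{X}\to\mathbb{K}$, equivalently one of the form $k(x,x')=\langle\Phi(x'),\Phi(x)\rangle_{\mathcal{H}}$ for some map $\Phi$ into a $\mathbb{K}$-Hilbert space $\mathcal{H}$. $H_k$ is the RKHS of $k$: the unique Hilbert space of functions $\mathcal{X}\to\mathbb{K}$ with $k(\cdot,x)\in H_k$ and $f(x)=\langle f,k(\cdot,x)\rangle_k$ for all $f\in H_k$, $x\in\mathcal{X}$. $\mathcal{L}^p$ denotes the space of $p$-integrable measurable functions and $L^p$ the corresponding space of equivalence classes modulo $\mu$-almost everywhere equality; the inclusion $\mathrm{id}$ sends $f\in H_k$ to its equivalence class. A function $f:\mathcal{X}\to\mathbb{K}$ is $\alpha$-H\''older continuous with H\''older constant $L\geq0$ if $|f(x)-f(x')|\leq L\,d_{\mathcal{X}}(x,x')^\alpha$ for all $x,x'\in\mathcal{X}$. *)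

(* Defs.v *)
From HB Require Import structures.
From mathcomp Require Import all_boot all_order all_algebra.
From mathcomp Require Import generic_quotient ring_quotient sesquilinear.
From mathcomp Require Import complex.
From mathcomp Require Import all_classical all_reals all_analysis.
From mathcomp Require Import measurable_realfun.

Set Implicit Arguments.
Unset Strict Implicit.
Unset Printing Implicit Defensive.

Import Order.TTheory GRing.Theory Num.Theory.
Import numFieldNormedType.Exports.

Local Open Scope classical_set_scope.
Local Open Scope ring_scope.
Local Open Scope quotient_scope.

Variant scalar_kind := real_scalars | complex_scalars.

Definition RorC (R : realType) (b : scalar_kind) : numFieldType :=
  match b with real_scalars => R | complex_scalars => R[i] end.

Section Scalars.
Variable R : realType.

Definition reK b : RorC R b -> R :=
  match b return RorC R b -> R with
  | real_scalars => fun z => z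
  | complex_scalars => fun z => complex.Re z
  end.

Definition imK b : RorC R b -> R :=
  match b return RorC R b -> R with
  | real_scalars => fun _ => 0
  | complex_scalars => fun z => complex.Im z
  end.

Definition mkK b : R -> R -> RorC R b :=
  match b return R -> R -> RorC R b with
  | real_scalars => fun x _ => x
  | complex_scalars => fun x y => (x +i* y)%C
  end.

Definition conjK b : RorC R b -> RorC R b :=
  match b return RorC R b -> RorC R b with
  | real_scalars => fun z => z
  | complex_scalars => fun z => (z^*)%C
  end.

(* [`|z|] is an element of [RorC R b]; [absK z] is the same number in R. *)
Definition absK b (z : RorC R b) : R := reK `|z|.

End Scalars.
Arguments reK {R b}.
Arguments imK {R b}.
Arguments mkK {R} b.
Arguments conjK {R b}.

Section ScalarTheory.
Variables (R : realType) (b : scalar_kind).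
Implicit Types (z w : RorC R b).

Lemma absKD z w : absK (z + w) <= absK z + absK w.
Proof.
rewrite /absK; case: b z w => z w /=; first exact: ler_normD.
exact: complex.le_normcD.
Qed.

Lemma absKM z w : absK (z * w) = absK z * absK w.
Proof.
rewrite /absK; case: b z w => z w /=; first by rewrite normrM.
exact: ComplexField.Normc.normcM.
Qed.

Lemma absK_ge0 z : 0 <= absK z.
Proof.
by rewrite /absK; case: b z => z /=; [exact: normr_ge0|case: z => x y /=; exact: sqrtr_ge0].
Qed.

Lemma absK0 : absK (0 : RorC R b) = 0.
Proof. by rewrite /absK normr0; case: b. Qed.

Lemma absK_sqrt z : absK z = Num.sqrt (reK z ^+ 2 + imK z ^+ 2).
Proof.
rewrite /absK; case: b z => z /=; last by case: z.
by rewrite expr0n/= addr0 sqrtr_sqr.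
Qed.

Lemma reK_mulD a z w :
  reK (a * z + w) = reK a * reK z - imK a * imK z + reK w.
Proof.
case: b a z w => [a z w|[? ?] [? ?] [? ?]] //=.
by rewrite mul0r subr0.
Qed.

Lemma imK_mulD a z w :
  imK (a * z + w) = reK a * imK z + imK a * reK z + imK w.
Proof.
case: b a z w => [a z w|[? ?] [? ?] [? ?]] //=.
by rewrite mulr0 mul0r !addr0.
Qed.

End ScalarTheory.

Section KValued.
Context d (X : measurableType d) (R : realType) (b : scalar_kind).
Implicit Types f : X -> RorC R b.

(* Measurability for the Borel sigma-algebra of R, resp. of R[i] = R^2. *)
Definition measurableK f :=
  measurable_fun setT (reK \o f) /\ measurable_fun setT (imK \o f).

Lemma measurable_absK f : measurableK f -> measurable_fun setT (@absK R b \o f).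
Proof.
move=> [mr mi].
rewrite (_ : _ \o f = Num.sqrt \o (fun x => reK (f x) ^+ 2 + imK (f x) ^+ 2)); last first.
  by apply/funext => x; rewrite /= absK_sqrt.
apply: measurableT_comp.
  by apply: continuous_measurable_fun; exact: sqrt_continuous.
apply: measurable_funD; [exact: (measurable_funX 2 mr)|exact: (measurable_funX 2 mi)].
Qed.

Lemma measurableK_scaleD a f g :
  measurableK f -> measurableK g -> measurableK (a *: f + g).
Proof.
move=> [mrf mif] [mrg mig]; split.
- rewrite (_ : _ \o _ = fun x => reK a * reK (f x) - imK a * imK (f x)
      + reK (g x)); last by apply/funext => x; exact: reK_mulD.
  by apply: measurable_funD => //; apply: measurable_funB; apply: measurable_funM.
- rewrite (_ : _ \o _ = fun x => reK a * imK (f x) + imK a * reK (f x)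
      + imK (g x)); last by apply/funext => x; exact: imK_mulD.
  by apply: measurable_funD => //; apply: measurable_funD; apply: measurable_funM.
Qed.

End KValued.

Section Lp.
Context d (X : measurableType d) (R : realType) (b : scalar_kind).
Variables (mu : {measure set X -> \bar R}) (p : R).
Local Notation K := (RorC R b).
Implicit Types f : X -> K.

Definition p_integrable : {pred X -> K} :=
  mem [set f | measurableK f /\
               (\int[mu]_x ((absK (f x)) `^ p)%:E < +oo)%E].

Record calLp (p1 : 1 <= p) :=
  MkCalLp {calLp_fun :> X -> K ; calLpP : calLp_fun \in p_integrable}.

Variable p1 : 1 <= p.

Let p_neq0 : p != 0. Proof. by rewrite gt_eqF// (lt_le_trans ltr01). Qed.

Lemma p_integrable_absK f :
  f \in p_integrable -> (@absK R b \o f : X -> R) \in Lfun mu p%:E.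
Proof.
rewrite inE => -[mf intf]; rewrite inE; apply/andP; split.
  by rewrite inE; exact: measurable_absK.
rewrite inE/= /finite_norm unlock; apply: poweR_lty.
by under eq_integral do rewrite /= ger0_norm ?absK_ge0//.
Qed.

Lemma p_integrable_submod_closed : submod_closed p_integrable.
Proof.
split.
  rewrite inE; split.
    by split; case: b => /=; exact: measurable_cst.
  under eq_integral do rewrite absK0 powR0//.
  by rewrite integral0.
move=> a f g fp gp; move: (fp) (gp); rewrite !inE => -[mf _] [mg _].
have mh := measurableK_scaleD a mf mg; split => //.
pose F : X -> R := absK a *: (@absK R b \o f) + (@absK R b \o g).
have FL : F \in Lfun mu p%:E.
  have p1' : (1 <= p%:E)%E by [].
  have [_ H] := Lfun_submod_closed mu p1'.
  by apply: H; exact: p_integrable_absK.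
have F0 x : 0 <= F x by rewrite addr_ge0 ?mulr_ge0 ?absK_ge0.
have /integrableP[mF] := Lfun_integrable p1 FL.
apply: le_lt_trans; apply: ge0_le_integral => //=.
- by move=> x _; rewrite lee_fin powR_ge0.
- apply/measurable_EFinP; apply: (measurableT_comp (measurable_powR _)).
  exact: (measurable_absK mh).
- apply: eq_measurable_fun mF => x _.
  by rewrite (ger0_norm (powR_ge0 _ _)).
- move=> x _; rewrite lee_fin (ger0_norm (powR_ge0 _ _)) (ger0_norm (F0 x)).
  apply: ge0_ler_powR; rewrite ?nnegrE ?absK_ge0 ?F0 ?(le_trans ler01 p1)//.
  by apply: (le_trans (absKD _ _)); rewrite absKM.
Qed.

HB.instance Definition _ := GRing.isSubmodClosed.Build _ _ p_integrable
  p_integrable_submod_closed.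

HB.instance Definition _ := [isSub for (@calLp_fun p1)].
HB.instance Definition _ := [Choice of calLp p1 by <:].
HB.instance Definition _ := [SubChoice_isSubLmodule of calLp p1 by <:].

Definition ae_null : {pred calLp p1} :=
  mem [set f : calLp p1 | {ae mu, forall x, f x = 0}].

Lemma ae_null_submod_closed : submod_closed ae_null.
Proof.
split; first by rewrite inE; exact/nearW.
move=> a f g; rewrite !inE /=; apply: filterS2 => x f0 g0.
by rewrite -[LHS]/(a * f x + g x) f0 g0 mulr0 addr0.
Qed.

HB.instance Definition _ := GRing.isSubmodClosed.Build _ _ ae_null
  ae_null_submod_closed.

Definition LpK : Type := {ideal_quot ae_null}.
HB.instance Definition _ := GRing.Zmodule.on LpK.
HB.instance Definition _ := EqQuotient.on LpK.

Definition LpK_class (f : calLp p1) : LpK := \pi_LpK f.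

Lemma LpK_classP (f g : calLp p1) :
  LpK_class f = LpK_class g <-> {ae mu, forall x, f x = g x}.
Proof.
rewrite /LpK_class; split => [/eqP|fg].
  rewrite -Quotient.idealrBE inE; apply: filterS => x /eqP.
  by rewrite subr_eq0 => /eqP.
apply/eqP; rewrite -Quotient.idealrBE inE; apply: filterS fg => x fgx.
by rewrite -[LHS]/(f x - g x) fgx subrr.
Qed.

Lemma LpK_classD (f g : calLp p1) :
  LpK_class (f + g) = LpK_class f + LpK_class g.
Proof. by rewrite /LpK_class !piE. Qed.

Definition LpK_scale (a : K) (u : LpK) : LpK := LpK_class (a *: repr u).

Lemma LpK_classZ a (f : calLp p1) :
  LpK_scale a (LpK_class f) = LpK_class (a *: f).
Proof.
apply/LpK_classP.
have /LpK_classP : LpK_class (repr (LpK_class f)) = LpK_class f.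
  exact: reprK.
by apply: filterS => x /(congr1 ( *%R a)).
Qed.

Lemma LpK_scaleA a b' u : LpK_scale a (LpK_scale b' u) = LpK_scale (a * b') u.
Proof. by rewrite -[u]reprK -/(LpK_class _) !LpK_classZ scalerA. Qed.

Lemma LpK_scale1 : left_id 1 LpK_scale.
Proof. by move=> u; rewrite -[u]reprK -/(LpK_class _) LpK_classZ scale1r. Qed.

Lemma LpK_scaleDr : right_distributive LpK_scale +%R.
Proof.
move=> a u v; rewrite -[u]reprK -[v]reprK -!/(LpK_class _).
by rewrite -LpK_classD !LpK_classZ scalerDr LpK_classD.
Qed.

Lemma LpK_scaleDl u : {morph LpK_scale^~ u : a b / a + b}.
Proof.
move=> a c /=.
by rewrite -[u]reprK -!/(LpK_class _) !LpK_classZ scalerDl LpK_classD.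
Qed.

HB.instance Definition _ :=
  GRing.Zmodule_isLmodule.Build K LpK LpK_scaleA LpK_scale1 LpK_scaleDr LpK_scaleDl.

(* Independent of the representative, see [LpK_normE]. *)
Definition LpK_norm (u : LpK) : R :=
  fine ('N[mu]_p%:E[EFin \o (@absK R b \o repr u)]).

Lemma LpK_normE (f : calLp p1) :
  LpK_norm (LpK_class f) = fine ('N[mu]_p%:E[EFin \o (@absK R b \o f)]).
Proof.
have /LpK_classP ff : LpK_class (repr (LpK_class f)) = LpK_class f.
  exact: reprK.
have mL (h : calLp p1) :
    measurable_fun setT (fun x => `|(EFin \o (@absK R b \o h)) x| `^ p)%E.
  have := calLpP h; rewrite inE => -[mh _].
  apply: measurableT_comp (measurable_poweR p) _.
  by apply: measurableT_comp => //; apply/measurable_EFinP/measurable_absK.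
rewrite /LpK_norm unlock; congr (fine (_ `^ _)%E).
apply: ge0_ae_eq_integral => //; try by move=> x _; exact: poweR_ge0.
by apply: filterS ff => x ffx _; rewrite /= ffx.
Qed.

End Lp.
Arguments p_integrable {d X R b} mu p.
Arguments LpK {d X R} b mu {p} p1.

Section Integral.
Context d (X : measurableType d) (R : realType) (b : scalar_kind).
Variable mu : {measure set X -> \bar R}.
Implicit Types f : X -> RorC R b.

Definition integrableK f :=
  mu.-integrable setT (EFin \o (reK \o f)) /\
  mu.-integrable setT (EFin \o (imK \o f)).

Definition integralK f : RorC R b :=
  mkK b (\int[mu]_x reK (f x)) (\int[mu]_x imK (f x)).

End Integral.

Section Kernels.
Variables (R : realType) (b : scalar_kind) (X : Type).
Local Notation K := (RorC R b).

Definition psd_kernel (k : X -> X -> K) :=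
  (forall x y, k x y = conjK (k y x)) /\
  (forall n (c : 'I_n -> K) (x : 'I_n -> X),
     0 <= \sum_(i < n) \sum_(j < n) conjK (c i) * c j * k (x i) (x j)).

(* A Hilbert space whose elements are functions X -> K through the injective
   linear map [rkhs_fun]. [{dot _ for conjK}] is linear in its first argument
   and conjugate-linear in the second one. *)
Record rkhs (k : X -> X -> K) := Rkhs {
  rkhs_space :> completeNormedModType K ;
  rkhs_dot : {dot rkhs_space for @conjK R b} ;
  rkhs_normE : forall f : rkhs_space, `|f| ^+ 2 = rkhs_dot f f ;
  rkhs_fun : {linear rkhs_space -> (X -> K)} ;
  rkhs_fun_inj : injective rkhs_fun ;
  rkhs_kernel : X -> rkhs_space ;
  rkhs_kernelE : forall x, rkhs_fun (rkhs_kernel x) = k^~ x ;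
  rkhs_reproducing : forall (f : rkhs_space) x,
    rkhs_fun f x = rkhs_dot f (rkhs_kernel x)
}.

End Kernels.

Definition separable_space (T : topologicalType) :=
  exists2 D : set T, countable D & dense D.

(* A metric and a sigma-algebra on the same type, with no relation between
   the two. *)
#[short(type="metricMeasurableType")]
HB.structure Definition MetricMeasurable (d : measure_display) (R : realType) :=
  {X of Metric R X & Measurable d X}.

Definition holder_continuous (R : realType) (b : scalar_kind) (X : metricType R)
    (alpha L : R) (f : X -> RorC R b) :=
  forall x x', absK (f x - f x') <= L * mdist x x' `^ alpha.

Section KernelLp.
Context d (X : measurableType d) (R : realType) (b : scalar_kind).
Variables (mu : {measure set X -> \bar R}) (p : R).
Variable k : X -> X -> RorC R b.

(* [k x x] is a nonnegative real number when [k] is positive semidefinite. *)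
Definition kernel_Lnorm : \bar R :=
  ((\int[mu]_x (reK (k x x) `^ (p / 2))%:E) `^ p^-1)%E.

Definition rkhs_id (p1 : 1 <= p) (H : rkhs k)
    (Hp : forall f : H, rkhs_fun H f \in p_integrable mu p) (f : H) :
    LpK b mu p1 :=
  LpK_class (MkCalLp p1 (Hp f)).

End KernelLp.

(* Main.v *)
From HB Require Import structures.
Require Import Defs.
From mathcomp Require Import all_boot all_order all_algebra.
From mathcomp Require Import all_classical all_reals all_analysis.
From mathcomp Require Import generic_quotient sesquilinear complex.
From mathcomp Require Import measurable_realfun ring lra.

Set Implicit Arguments.
Unset Strict Implicit.
Unset Printing Implicit Defensive.

Import Order.TTheory GRing.Theory Num.Theory.
Import numFieldNormedType.Exports.

Local Open Scope classical_set_scope.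
Local Open Scope ring_scope.

(** Write [kappa x] for the norm of the kernel section [k(., x)] in [Hk], so
that [kappa x ^ 2 = k x x] and the hypothesis on the diagonal of [k] says that
[kappa] is in L^p.  The reproducing property and the Cauchy-Schwarz inequality
give [|f x| <= |f| * kappa x] for every [f] in [Hk]; hence every function of
[Hk] is p-integrable as soon as it is measurable, and by Hoelder's inequality
[f |-> \int f * conj g] is a bounded linear functional on [Hk] for every [g] in
L^q.  Its Riesz representer is [S g]: evaluating [<S g, k(., x)>] gives the
integral formula [kernel_operatorE], and the bound on the functional gives the
bound [kernel_operator_norm_le] on [|S g|].  The Hoelder continuity of [S g] is
Hoelder's inequality again ([integralK_hoelder]), applied to
[k x x' - k y x'], which is at most [La x' * mdist x y ^ alpha] in absolute
value for almost all [x'].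

For density, let [f] be orthogonal to the range of [S].  Then
[\int f * conj g = 0] for all [g] in L^q, and [g = |f|^(p-2) f] gives
[\int |f|^p = 0], so that [f] vanishes almost everywhere
([p_integrable_dual0]); injectivity of the inclusion into L^p yields [f = 0].

The measurability of the functions of [Hk] comes from the same density
criterion: the vectors whose function is measurable form a subspace that
contains all the [k(., x)], hence has trivial orthogonal complement, and
convergence in [Hk] implies pointwise convergence.

Both the Riesz representation and the density criterion follow from one
statement, [riesz_on_subspace]: a bounded functional [phi] on a subspace [V],
closed or not, is represented on [V] by a limit of elements of [V], obtained by
minimising [|v|^2 - 2 Re (phi v)] over [V].  Taking [V] to be the whole space
gives the Riesz theorem; taking [phi v = <v, f>] gives an approximation of [f]
by elements of [V], up to a vector orthogonal to [V]. *)

(** * Real and complex scalars *)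

Section ScalarFacts.
Variables (R : realType) (b : scalar_kind).
Implicit Types (z w a : RorC R b) (x y : R).

Lemma reKD z w : reK (z + w) = reK z + reK w.
Proof. by case: b z w => // -[? ?] [? ?]. Qed.

Lemma imKD z w : imK (z + w) = imK z + imK w.
Proof. by case: b z w => /= [z w|[? ?] [? ?] //]; rewrite addr0. Qed.

Lemma reKN z : reK (- z) = - reK z.
Proof. by case: b z => // -[? ?]. Qed.

Lemma imKN z : imK (- z) = - imK z.
Proof. by case: b z => /= [z|[? ?] //]; rewrite oppr0. Qed.

Lemma reK0 : reK (0 : RorC R b) = 0.
Proof. by case: b. Qed.

Lemma imK0 : imK (0 : RorC R b) = 0.
Proof. by case: b. Qed.

Lemma mkK1 : mkK b 1 0 = 1 :> RorC R b.
Proof. by case: b. Qed.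

Lemma reKM z w : reK (z * w) = reK z * reK w - imK z * imK w.
Proof. by rewrite -[z * w]addr0 reK_mulD reK0 addr0. Qed.

Lemma imKM z w : imK (z * w) = reK z * imK w + imK z * reK w.
Proof. by rewrite -[z * w]addr0 imK_mulD imK0 addr0. Qed.

Lemma reK_conj z : reK (conjK z) = reK z.
Proof. by case: b z => // -[? ?]. Qed.

Lemma imK_conj z : imK (conjK z) = - imK z.
Proof. by case: b z => /= [z|[? ?] //]; rewrite oppr0. Qed.

Lemma eqK z w : reK z = reK w -> imK z = imK w -> z = w.
Proof. by case: b z w => //= -[? ?] [? ?] /= -> ->. Qed.

Lemma reK_mk x y : reK (mkK b x y) = x.
Proof. by case: b. Qed.

Lemma imK_mk0 x : imK (mkK b x 0) = 0.
Proof. by case: b. Qed.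

Lemma conjKK : involutive (@conjK R b).
Proof. by move=> z; apply: eqK; rewrite ?reK_conj ?imK_conj ?opprK. Qed.

Lemma conjK0 : conjK (0 : RorC R b) = 0.
Proof. by apply: eqK; rewrite ?reK_conj ?imK_conj ?imK0 ?oppr0. Qed.

Lemma conjKM z w : conjK (z * w) = conjK z * conjK w.
Proof. by apply: eqK; rewrite ?(reKM, imKM, reK_conj, imK_conj); ring. Qed.

Lemma absKE z : absK z ^+ 2 = reK z ^+ 2 + imK z ^+ 2.
Proof. by rewrite absK_sqrt sqr_sqrtr// addr_ge0 ?sqr_ge0. Qed.

Lemma absK_conj z : absK (conjK z) = absK z.
Proof. by rewrite !absK_sqrt reK_conj imK_conj sqrrN. Qed.

Lemma absK_eq0 z : absK z = 0 -> z = 0.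
Proof.
move=> /eqP; rewrite -sqrf_eq0 absKE paddr_eq0 ?sqr_ge0// !sqrf_eq0.
by move=> /andP[/eqP r0 /eqP i0]; apply: eqK; rewrite ?reK0 ?imK0.
Qed.

Lemma reK_le_abs z : `|reK z| <= absK z.
Proof. by rewrite absK_sqrt -sqrtr_sqr ler_wsqrtr// lerDl sqr_ge0. Qed.

Lemma imK_le_abs z : `|imK z| <= absK z.
Proof. by rewrite absK_sqrt -sqrtr_sqr ler_wsqrtr// lerDr sqr_ge0. Qed.

Lemma absK_mk0 x : 0 <= x -> absK (mkK b x 0) = x.
Proof.
by move=> x0; rewrite absK_sqrt reK_mk imK_mk0 expr0n addr0 sqrtr_sqr ger0_norm.
Qed.

Lemma reK_conj_mul z : reK (conjK z * z) = absK z ^+ 2.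
Proof. by rewrite absKE reKM reK_conj imK_conj; ring. Qed.

Lemma ge0_imK z : 0 <= z -> imK z = 0.
Proof. by case: b z => // -[u v]; rewrite lecE/= => /andP[/eqP]. Qed.

Lemma ltrK z w : imK z = 0 -> imK w = 0 -> (z < w) = (reK z < reK w).
Proof. by case: b z w => // -[? ?] [? ?] /= -> ->; rewrite ltcE/= eqxx. Qed.

Lemma reK_le z w : 0 <= w -> z <= w -> reK z <= reK w.
Proof.
case: b z w => // -[? ?] [? ?].
by rewrite !lecE /= => /andP[_ _] /andP[].
Qed.

End ScalarFacts.

(** * Riesz representation and density in Hilbert spaces *)

Section HilbertSpace.
Variables (R : realType) (b : scalar_kind).
Local Notation K := (RorC R b).
Variables (H : completeNormedModType K) (dot : {dot H for @conjK R b}).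
Hypothesis dotE : forall f : H, `|f| ^+ 2 = dot f f.
Implicit Types (f g h u v w : H) (a : K) (t : R).

(** The norm of [f] as an element of [R] rather than of the scalar field. *)
Definition norm_re f : R := reK `|f|.

Lemma norm_re_ge0 f : 0 <= norm_re f.
Proof. by rewrite -(reK0 R b); apply: reK_le. Qed.

Lemma norm_reE f : norm_re f ^+ 2 = reK (dot f f).
Proof. by rewrite -dotE !expr2 reKM ge0_imK// mulr0 subr0. Qed.

Lemma norm_reZ a f : norm_re (a *: f) = absK a * norm_re f.
Proof.
by rewrite /norm_re normrZ reKM [imK `|a|]ge0_imK// mul0r subr0.
Qed.

Lemma norm_reBC f g : norm_re (f - g) = norm_re (g - f).
Proof. by rewrite /norm_re distrC. Qed.

Lemma norm_re_eq0 f : norm_re f = 0 -> f = 0.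
Proof.
move=> f0; apply/normr0_eq0/eqK; rewrite ?reK0 ?imK0//.
exact: ge0_imK.
Qed.

Lemma dotC f g : dot f g = conjK (dot g f).
Proof. by rewrite [LHS]hermitian_subproof expr0 mul1r. Qed.

Lemma dotDl f g h : dot (f + g) h = dot f h + dot g h.
Proof.
have dB u v : dot (u - v) h = dot u h - dot v h.
  exact: zmod_morphisml_subproof.
have d0 : dot 0 h = 0 by rewrite -(subrr 0) dB subrr.
by rewrite -[g in LHS]opprK dB -(sub0r g) dB d0 sub0r opprK.
Qed.

Lemma dotZl a f h : dot (a *: f) h = a * dot f h.
Proof. exact: linearl_subproof. Qed.

(** The real inner product underlying [dot]. *)
Definition rdot f g : R := reK (dot f g).

Lemma rdotC f g : rdot f g = rdot g f.
Proof. by rewrite /rdot dotC reK_conj. Qed.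

Lemma rdotDl f g h : rdot (f + g) h = rdot f h + rdot g h.
Proof. by rewrite /rdot dotDl reKD. Qed.

Lemma rdotDr f g h : rdot f (g + h) = rdot f g + rdot f h.
Proof. by rewrite rdotC rdotDl !(rdotC f). Qed.

Lemma rdotNl f h : rdot (- f) h = - rdot f h.
Proof. by rewrite /rdot -scaleN1r dotZl mulN1r reKN. Qed.

Lemma rdotNr f h : rdot h (- f) = - rdot h f.
Proof. by rewrite rdotC rdotNl rdotC. Qed.

Lemma rdotZl t f h : rdot (mkK b t 0 *: f) h = t * rdot f h.
Proof. by rewrite /rdot dotZl reKM reK_mk imK_mk0 mul0r subr0. Qed.

Lemma rdotZr t f h : rdot h (mkK b t 0 *: f) = t * rdot h f.
Proof. by rewrite rdotC rdotZl rdotC. Qed.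

Let normE f : norm_re f ^+ 2 = rdot f f := norm_reE f.

Lemma rdot_le f g : rdot f g <= norm_re f * norm_re g.
Proof.
have [f0|fn0] := eqVneq (norm_re f) 0.
  by rewrite f0 mul0r (norm_re_eq0 f0) -(scale0r 0) /rdot dotZl mul0r reK0.
have [g0|gn0] := eqVneq (norm_re g) 0.
  by rewrite g0 mulr0 (norm_re_eq0 g0) rdotC -(scale0r 0) /rdot dotZl mul0r
       reK0.
have fg0 : 0 < norm_re f * norm_re g.
  by rewrite mulr_gt0// lt0r norm_re_ge0 andbT.
have := sqr_ge0 (norm_re (mkK b (norm_re g) 0 *: f - mkK b (norm_re f) 0 *: g)).
rewrite normE !(rdotDl, rdotDr, rdotNl, rdotNr, rdotZl, rdotZr) -!normE.
rewrite (rdotC g).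
move: fg0; set a := norm_re f; set c := norm_re g; set D := rdot f g => ac0 h.
have : 0 <= (a * c) * (a * c - D) by nra.
by rewrite pmulr_rge0// subr_ge0.
Qed.

Lemma absK_dot_le f g : absK (dot f g) <= norm_re f * norm_re g.
Proof.
have [z0|zn0] := eqVneq (absK (dot f g)) 0.
  by rewrite z0 mulr_ge0 ?norm_re_ge0.
have z0 : 0 < absK (dot f g) by rewrite lt0r zn0 absK_ge0.
have := rdot_le (conjK (dot f g) *: f) g.
rewrite /rdot dotZl reK_conj_mul norm_reZ absK_conj expr2 -mulrA.
by rewrite ler_pM2l.
Qed.

(** Completeness for sequences, with the norm read in [R]. *)
Lemma norm_re_complete (v : nat -> H) :
  (forall e : R, 0 < e -> exists n0, forall n, (n0 <= n)%N ->
    norm_re (v n0 - v n) < e) ->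
  exists h, norm_re (v n - h) @[n --> \oo] --> 0.
Proof.
move=> cv.
have imN f : imK `|f| = 0 by apply: ge0_imK.
have /cauchy_cvg/cvg_ex[h vh] : cauchy (v @ \oo).
  apply: cauchy_exP => e e0.
  have [|n0 hn0] := cv (reK e).
    by rewrite -(reK0 R b) -ltrK ?imK0// ge0_imK// ltW.
  exists (v n0); exists n0 => // n /= /hn0.
  by rewrite -ball_normE /= ltrK ?imN// ge0_imK// ltW.
exists h; apply/cvgrPdist_lt => e e0.
have e'0 : 0 < mkK b e 0.
  by rewrite ltrK ?imK_mk0 ?imK0// reK_mk reK0.
move/cvgrPdist_lt : vh => /(_ _ e'0); apply: filterS => n.
rewrite ltrK ?imK_mk0 ?imN// reK_mk sub0r normrN ger0_norm ?norm_re_ge0//.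
by rewrite norm_reBC.
Qed.

(** The subspace [V] need not be closed: the representer [h] lies in its
closure, as the limit of a minimising sequence of [|v|^2 - 2 Re (phi v)]. *)
Lemma riesz_on_subspace (V : set H) (phi : H -> K) (C : R) :
  V 0 -> (forall a u v, V u -> V v -> V (a *: u + v)) ->
  (forall a u v, V u -> V v -> phi (a *: u + v) = a * phi u + phi v) ->
  (forall v, V v -> absK (phi v) <= C * norm_re v) ->
  exists h, exists v_ : nat -> H, [/\ forall n, V (v_ n),
    norm_re (v_ n - h) @[n --> \oo] --> 0 & forall v, V v -> phi v = dot v h].
Proof.
move=> V0 VD phiD phiC.
have VZ a u : V u -> V (a *: u) by move=> Vu; rewrite -[_ *: _]addr0; exact: VD.
have VA u v : V u -> V v -> V (u + v).
  by move=> Vu Vv; rewrite -[u]scale1r; exact: VD.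
have phi0 : phi 0 = 0.
  by have := phiD (-1) 0 0 V0 V0; rewrite scaler0 addr0 mulN1r addNr.
have phiZ a u : V u -> phi (a *: u) = a * phi u.
  by move=> Vu; rewrite -[_ *: _]addr0 phiD// phi0 addr0.
have phiA u v : V u -> V v -> phi (u + v) = phi u + phi v.
  by move=> Vu Vv; rewrite -[u in LHS]scale1r phiD// mul1r.
pose J u := norm_re u ^+ 2 - 2 * reK (phi u).
have J_ge u : V u -> - C ^+ 2 <= J u.
  move=> /phiC phiu.
  have := le_trans (ler_norm _) (le_trans (reK_le_abs (phi u)) phiu).
  rewrite /J; move: (norm_re u) (reK _) => N r rN.
  by have := sqr_ge0 (N - C); nra.
have infJ : has_inf [set J u | u in V].
  split; first by exists (J 0), 0.
  by exists (- C ^+ 2) => _ [u Vu <-]; exact: J_ge.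
set m := inf [set J u | u in V].
have m_le u : V u -> m <= J u.
  by move=> Vu; apply: ge_inf; [case: infJ|exists u].
have minJ n : exists u, V u /\ J u < m + n.+1%:R^-1.
  have [] := @inf_adherent _ _ n.+1%:R^-1 _ infJ; first by rewrite invr_gt0.
  by move=> _ [u Vu <-] ?; exists u.
have [v_ v_P] := choice minJ.
(* Expansion of [J] along the line through [u] with direction [v]. *)
have JE u v t : V u -> V v -> J (u + mkK b t 0 *: v) =
    J u + 2 * t * (rdot v u - reK (phi v)) + t ^+ 2 * norm_re v ^+ 2.
  move=> Vu Vv; rewrite /J phiA//; last exact: VZ.
  rewrite phiZ// reKD reKM reK_mk imK_mk0.
  rewrite !normE !(rdotDl, rdotDr, rdotZl, rdotZr) (rdotC u v).
  ring.
(* Parallelogram identity: the midpoint of [u] and [v] is in [V], hence the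
   value of [J] there is at least [m]. *)
have para u v : V u -> V v ->
    norm_re (u - v) ^+ 2 <= 2 * (J u - m) + 2 * (J v - m).
  move=> Vu Vv.
  have Vd : V (v - u) by apply: VA => //; rewrite -scaleN1r; exact: VZ.
  have := m_le (u + mkK b (2^-1) 0 *: (v - u)); rewrite JE//.
  move=> /(_ (VA _ _ Vu (VZ _ _ Vd))).
  have -> : J v = J (u + mkK b 1 0 *: (v - u)).
    by rewrite mkK1 scale1r (addrC u) subrK.
  rewrite JE// (norm_reBC u v); nra.
have [h vh] : exists h, norm_re (v_ n - h) @[n --> \oo] --> 0.
  apply: norm_re_complete => e e0.
  have : \forall n \near \oo, n.+1%:R^-1 < e ^+ 2 / 4.
    have e4 : 0 < e ^+ 2 / 4 by rewrite divr_gt0 ?exprn_gt0.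
    exact: (near_infty_natSinv_lt (PosNum e4)).
  move=> [n0 _ hn0]; exists n0 => n n0n.
  rewrite -(@ltr_pXn2r _ 2) ?nnegrE ?norm_re_ge0 ?(ltW e0)//.
  have [Vn0 Jn0] := v_P n0; have [Vn Jn] := v_P n.
  apply: le_lt_trans (para _ _ Vn0 Vn) _.
  have h0 : n0.+1%:R^-1 < e ^+ 2 / 4 := hn0 _ (leqnn _).
  have h1 : n.+1%:R^-1 < e ^+ 2 / 4 := hn0 _ n0n.
  rewrite -ltrBlDl in Jn0; rewrite -ltrBlDl in Jn.
  have {Jn0}h0 := lt_trans Jn0 h0; have {Jn}h1 := lt_trans Jn h1.
  have -> : e ^+ 2 = 2 * (e ^+ 2 / 4) + 2 * (e ^+ 2 / 4) by field.
  by rewrite ltrD// ltr_pM2l.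
exists h, v_; split => //; first by move=> n; have [] := v_P n.
(* First-order condition at the minimum, for the real part. *)
have reE w : V w -> rdot w h = reK (phi w).
  move=> Vw.
  have quad t : 0 <= 2 * t * (rdot w h - reK (phi w)) + t ^+ 2 * norm_re w ^+ 2.
    set c := (X in 0 <= X).
    have: (fun n =>
        c + (n.+1%:R^-1 + 2 * `|t| * norm_re w * norm_re (v_ n - h)))
        @ \oo --> c + (0 + 2 * `|t| * norm_re w * 0).
      apply: cvgD; first exact: cvg_cst.
      apply: cvgD; first exact: cvg_harmonic.
      by apply: cvgM => //; exact: cvg_cst.
    rewrite mulr0 !addr0 => /cvgr_to_ge; apply; apply: nearW => n.
    have [Vn Jn] := v_P n.
    have := m_le _ (VA _ _ Vn (VZ (mkK b t 0) _ Vw)); rewrite JE//.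
    have -> : rdot w (v_ n) = rdot w h + rdot w (v_ n - h).
      by rewrite -rdotDr addrC subrK.
    have : t * rdot w (v_ n - h) <= `|t| * norm_re w * norm_re (v_ n - h).
      apply: (le_trans (ler_norm _)); rewrite normrM -mulrA ler_wpM2l//.
      exact: le_trans (reK_le_abs _) (absK_dot_le _ _).
    rewrite -ltrBlDl in Jn.
    have -> : 2 * t * (rdot w h + rdot w (v_ n - h) - reK (phi w)) =
      2 * t * (rdot w h - reK (phi w)) + 2 * (t * rdot w (v_ n - h)) by ring.
    rewrite /c -!(mulrA 2) mulrA; move: Jn.
    set y := 2 * t * _; set A := `|t| * _; set B := t * _; set D := t ^+ 2 * _.
    move: (J _) n.+1%:R^-1 => j i ji BA mj; lra.
  (* The denominator is shifted by 1 because the norm of [w] may vanish. *)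
  have := quad (- (rdot w h - reK (phi w)) / (norm_re w ^+ 2 + 1)).
  move: (sqr_ge0 (norm_re w)); move: (norm_re w ^+ 2) => s s0.
  apply: contraPP => /eqP; rewrite -subr_eq0; set D := rdot w h - _ => D0.
  apply/negP; rewrite -ltNge.
  have q0 : 0 < (s + 1)^-1 by rewrite invr_gt0 ltr_wpDl.
  have -> : 2 * (- D / (s + 1)) * D + (- D / (s + 1)) ^+ 2 * s =
            - (D ^+ 2 * ((s + 1)^-1 * (1 + (s + 1)^-1))).
    by field; rewrite gt_eqF// ltr_wpDl.
  rewrite oppr_lt0 mulr_gt0//; first by rewrite lt0r sqrf_eq0 D0 sqr_ge0.
  by rewrite mulr_gt0// addr_gt0.
move=> w Vw; apply/eqP; rewrite -subr_eq0; apply/eqP/absK_eq0.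
set z := phi w - _; apply/eqP; rewrite -sqrf_eq0 -reK_conj_mul.
(* Applied to a multiple of [w], the real part controls the modulus. *)
have := reE (conjK z *: w) (VZ _ _ Vw).
rewrite phiZ// /rdot dotZl => /eqP; rewrite eq_sym -subr_eq0 -reKN -reKD.
by rewrite -mulrBr.
Qed.

(** A subspace with trivial orthogonal complement approximates every [f]: the
functional [<., f>] has a representer [h] in the closure of [V], and [f - h] is
orthogonal to [V]. *)
Lemma orthogonal_trivial_approx (V : set H) :
  V 0 -> (forall a u v, V u -> V v -> V (a *: u + v)) ->
  (forall f, (forall v, V v -> dot v f = 0) -> f = 0) ->
  forall f, exists2 v_ : nat -> H, forall n, V (v_ n) &
    norm_re (v_ n - f) @[n --> \oo] --> 0.
Proof.
move=> V0 VD Vperp f.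
have [h [v_ [Vv_ v_h hE]]] : exists h, exists v_ : nat -> H,
    [/\ forall n, V (v_ n),
    norm_re (v_ n - h) @[n --> \oo] --> 0 & forall v, V v -> dot v f = dot v h].
  apply: (@riesz_on_subspace V (dot^~ f) (norm_re f)) => //.
  - by move=> a u v _ _; rewrite dotDl dotZl.
  - by move=> v _; rewrite mulrC absK_dot_le.
suff -> : f = h by exists v_.
apply/eqP; rewrite -subr_eq0; apply/eqP/Vperp => v Vv.
by rewrite dotC dotDl -scaleN1r dotZl mulN1r (dotC f) (dotC h) hE//
     subrr conjK0.
Qed.

Lemma orthogonal_trivial_dense (V : set H) :
  V 0 -> (forall a u v, V u -> V v -> V (a *: u + v)) ->
  (forall f, (forall v, V v -> dot v f = 0) -> f = 0) -> dense V.
Proof.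
move=> V0 VD Vperp O [f Of] oO.
have [v_ Vv_ v_f] := orthogonal_trivial_approx V0 VD Vperp f.
have /nbhs_ballP[e /= e0 eO] : nbhs f O by exact: open_nbhs_nbhs.
have re0 : 0 < reK e by rewrite -(reK0 R b) -ltrK ?imK0// ge0_imK// ltW.
move/cvgrPdist_lt : v_f => /(_ _ re0)[n _ /(_ n (leqnn _))].
rewrite /= sub0r normrN ger0_norm ?norm_re_ge0// norm_reBC => fv.
exists (v_ n); split => //; apply: eO.
by rewrite -ball_normE /= ltrK// ge0_imK// ltW.
Qed.

End HilbertSpace.

(** * Integrals of scalar-valued functions *)

Section Integration.
Context d (X : measurableType d) (R : realType) (b : scalar_kind).
Variable mu : {measure set X -> \bar R}.
Local Notation K := (RorC R b).
Implicit Types (f g h : X -> K) (a : K).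

Lemma measurableKM f g : measurableK f -> measurableK g ->
  measurableK (fun x => f x * g x).
Proof.
move=> [mrf mif] [mrg mig]; split.
- rewrite (_ : _ \o _ = fun x => reK (f x) * reK (g x) - imK (f x) * imK (g x)).
    by apply: measurable_funB; apply: measurable_funM.
  by apply/funext => x /=; rewrite reKM.
- rewrite (_ : _ \o _ = fun x => reK (f x) * imK (g x) + imK (f x) * reK (g x)).
    by apply: measurable_funD; apply: measurable_funM.
  by apply/funext => x /=; rewrite imKM.
Qed.

Lemma measurableK_conj f : measurableK f -> measurableK (fun x => conjK (f x)).
Proof.
move=> [mr mi]; split.
- by rewrite (_ : _ \o _ = reK \o f)//; apply/funext => x /=; rewrite reK_conj.
- rewrite (_ : _ \o _ = \- (imK \o f)); first exact: measurable_funN.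
  by apply/funext => x /=; rewrite imK_conj.
Qed.

Lemma measurableK_mk (u v : X -> R) :
  measurable_fun setT u -> measurable_fun setT v ->
  measurableK (fun x => mkK b (u x) (v x)).
Proof.
by case: (b) => mu' mv; split => //=; exact: measurable_cst.
Qed.

Lemma integrableK_abs f : measurableK f ->
  (\int[mu]_x (absK (f x))%:E < +oo)%E -> integrableK mu f.
Proof.
move=> mf foo; have [mr mi] := mf.
have dom (u : X -> R) : measurable_fun setT u ->
    (forall x, `|u x| <= absK (f x)) -> mu.-integrable setT (EFin \o u).
  move=> mu_ uf; apply/integrableP; split; first exact/measurable_EFinP.
  apply: le_lt_trans foo; apply: ge0_le_integral => //=.
  - by apply/measurable_EFinP/measurableT_comp.
  - exact/measurable_EFinP/(measurable_absK mf).
  - by move=> x _; rewrite lee_fin.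
by split; apply: dom => // x; [exact: reK_le_abs|exact: imK_le_abs].
Qed.

Lemma integrableK_measurable f : integrableK mu f -> measurableK f.
Proof.
by move=> [/integrableP[? _] /integrableP[? _]]; split;
  exact/measurable_EFinP.
Qed.

Lemma reK_integralK f : reK (integralK mu f) = \int[mu]_x reK (f x).
Proof. exact: reK_mk. Qed.

Lemma imK_integralK f : imK (integralK mu f) = \int[mu]_x imK (f x).
Proof.
rewrite /integralK; case: (b) f => //= f.
by rewrite /Rintegral integral0.
Qed.

(** The triangle inequality for integrals. *)
Lemma absK_integralK f : integrableK mu f ->
  ((absK (integralK mu f))%:E <= \int[mu]_x (absK (f x))%:E)%E.
Proof.
move=> [ir ii]; set z := integralK mu f.
have mf : measurableK f := integrableK_measurable (conj ir ii).
have int0 : (0 <= \int[mu]_x (absK (f x))%:E)%E.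
  by apply: integral_ge0 => x _; rewrite lee_fin absK_ge0.
have [->//|z0] := eqVneq (absK z) 0.
have z_gt0 : 0 < absK z by rewrite lt0r z0 absK_ge0.
(* The integrand [u] is the real part of [conj z * f]: rotating the integral to
   the positive axis turns its modulus into the integral of a real part. *)
pose u x := reK z * reK (f x) + imK z * imK (f x).
have iru : mu.-integrable setT (EFin \o (fun x => reK z * reK (f x))).
  by rewrite (_ : _ \o _ = fun x => ((reK z)%:E * (EFin \o (reK \o f)) x)%E)//;
    exact: integrableZl.
have iiu : mu.-integrable setT (EFin \o (fun x => imK z * imK (f x))).
  by rewrite (_ : _ \o _ = fun x => ((imK z)%:E * (EFin \o (imK \o f)) x)%E)//;
    exact: integrableZl.
have iu : mu.-integrable setT (EFin \o u).
  by rewrite (_ : _ \o _ = fun x =>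
      ((reK z * reK (f x))%:E + (imK z * imK (f x))%:E)%E)//;
    exact: integrableD.
have uE : \int[mu]_x u x = absK z ^+ 2.
  rewrite RintegralD// !RintegralZl// absKE !expr2.
  by rewrite -reK_integralK -imK_integralK.
rewrite -(@lee_pmul2l _ (absK z)%:E)//.
rewrite -ge0_integralZl_EFin//=; last first.
- by rewrite ltW.
- exact/measurable_EFinP/(measurable_absK mf).
- by move=> x _; rewrite lee_fin absK_ge0.
rewrite -EFinM -expr2 -uE /Rintegral fineK; last exact: integrable_fin_num.
apply: (le_trans (lee_abs _)); apply: (le_trans (le_abse_integral _ _ _)) => //.
  by case/integrableP: iu.
have [_ /measurable_EFinP mu_] : True /\ measurable_fun setT (EFin \o u).
  by split => //; case/integrableP: iu.
apply: ge0_le_integral => //=.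
- by apply/measurable_EFinP/measurableT_comp.
- apply/measurable_EFinP/measurable_funM => //; exact: measurable_absK.
- move=> x _; rewrite lee_fin.
  have -> : u x = reK (conjK z * f x).
    by rewrite reKM reK_conj imK_conj /u; ring.
  by apply: (le_trans (reK_le_abs _)); rewrite absKM absK_conj.
Qed.

Lemma integrableK_conj f : integrableK mu f ->
  integrableK mu (fun x => conjK (f x)).
Proof.
move=> [ir ii]; split.
- rewrite (_ : _ \o _ = EFin \o (reK \o f))//.
  by apply/funext => x /=; rewrite reK_conj.
- rewrite (_ : _ \o _ = (\- (EFin \o (imK \o f)))%E); first exact: integrableN.
  by apply/funext => x /=; rewrite imK_conj.
Qed.

Lemma integralK_conj f : integrableK mu f ->
  integralK mu (fun x => conjK (f x)) = conjK (integralK mu f).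
Proof.
move=> [ir ii]; apply: eqK.
  rewrite reK_conj !reK_integralK.
  by apply: eq_Rintegral => x _; rewrite reK_conj.
rewrite imK_conj !imK_integralK -mulN1r -RintegralZl//.
by apply: eq_Rintegral => x _; rewrite imK_conj mulN1r.
Qed.

Lemma integralK_linear a f g : integrableK mu f -> integrableK mu g ->
  integralK mu (fun x => a * f x + g x) = a * integralK mu f + integralK mu g.
Proof.
move=> [irf iif] [irg iig].
have iZ (t : R) (u : X -> R) : mu.-integrable setT (EFin \o u) ->
    mu.-integrable setT (EFin \o (fun x => t * u x)).
  move=> iu; rewrite (_ : _ \o _ = fun x => (t%:E * (EFin \o u) x)%E)//.
  exact: integrableZl.
have iD (u v : X -> R) : mu.-integrable setT (EFin \o u) ->
    mu.-integrable setT (EFin \o v) ->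
    mu.-integrable setT (EFin \o (fun x => u x + v x)).
  by move=> iu iv; rewrite (_ : _ \o _ = ((EFin \o u) \+ (EFin \o v))%E)//;
     exact: integrableD.
have iB (u v : X -> R) : mu.-integrable setT (EFin \o u) ->
    mu.-integrable setT (EFin \o v) ->
    mu.-integrable setT (EFin \o (fun x => u x - v x)).
  by move=> iu iv; rewrite (_ : _ \o _ = ((EFin \o u) \- (EFin \o v))%E)//;
     exact: integrableB.
apply: eqK.
  rewrite reK_mulD !(reK_integralK, imK_integralK).
  rewrite -!RintegralZl// -RintegralB ?iZ// -RintegralD ?iB ?iZ//.
  by apply: eq_Rintegral => x _; rewrite reK_mulD.
rewrite imK_mulD !(reK_integralK, imK_integralK).
rewrite -!RintegralZl// -RintegralD ?iZ// -RintegralD ?iD ?iZ//.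
by apply: eq_Rintegral => x _; rewrite imK_mulD.
Qed.

Lemma ae_eq_integralK f g : measurableK f -> measurableK g ->
  {ae mu, forall x, f x = g x} -> integralK mu f = integralK mu g.
Proof.
move=> [mrf mif] [mrg mig] fg; congr (mkK b (fine _) (fine _));
  apply: ae_eq_integral => //; (try exact/measurable_EFinP);
  by apply: filterS fg => x fgx _; rewrite fgx.
Qed.

(** Hoelder's inequality for a function dominated almost everywhere by a
multiple of a function of L^p. *)
Lemma integralK_hoelder (p q t : R) (A : X -> R) f g :
  0 < p -> 0 < q -> 0 <= t -> p^-1 + q^-1 = 1 ->
  measurableK f -> A \in Lfun mu p%:E ->
  {ae mu, forall x, absK (f x) <= t * A x} ->
  g \in p_integrable mu q ->
  integrableK mu (fun x => f x * g x) /\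
  absK (integralK mu (fun x => f x * g x)) <=
    t * (fine ('N[mu]_p%:E[EFin \o A]) *
         fine ('N[mu]_q%:E[EFin \o (@absK R b \o g)])).
Proof.
move=> p0 q0 t0 pq mf AL fA gq.
have mA : measurable_fun setT A.
  by move: AL; rewrite inE => /andP[]; rewrite inE.
have Nfin (r : R) (u : X -> R) : ('N[mu]_r%:E[EFin \o u] < +oo)%E ->
    (fine 'N[mu]_r%:E[EFin \o u])%:E = 'N[mu]_r%:E[EFin \o u]%E.
  by move=> uoo; rewrite fineK// ge0_fin_numE// Lnorm_ge0.
have NA : ('N[mu]_p%:E[EFin \o A] < +oo)%E.
  by move: AL; rewrite inE => /andP[_]; rewrite inE.
move: (gq); rewrite inE => -[mg goo].
have Ng : ('N[mu]_q%:E[EFin \o (@absK R b \o g)] < +oo)%E.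
  rewrite unlock; apply: poweR_lty.
  by under eq_integral do rewrite /= ger0_norm ?absK_ge0//.
have mfg := measurableKM mf mg.
have le_fg : (\int[mu]_x (absK (f x * g x))%:E <=
    (t * (fine 'N[mu]_p%:E[EFin \o A] *
          fine 'N[mu]_q%:E[EFin \o (@absK R b \o g)]))%:E)%E.
  rewrite EFinM EFinM !Nfin//.
  have t0' : (0 <= t%:E)%E by [].
  apply: le_trans
    (lee_wpmul2l t0' (hoelder mu mA (measurable_absK mg) p0 q0 pq)).
  have mAg : measurable_fun setT (fun x => `|A x * absK (g x)|).
    apply: measurableT_comp => //; apply: measurable_funM => //.
    exact: measurable_absK.
  rewrite Lnorm1 -ge0_integralZl_EFin//=; last exact/measurable_EFinP.
  apply: ae_ge0_le_integral => //=.
  - by move=> x _; rewrite lee_fin absK_ge0.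
  - exact/measurable_EFinP/(measurable_absK mfg).
  - by move=> x _; rewrite -EFinM lee_fin mulr_ge0.
  - by apply/measurable_EFinP/measurable_funM.
  - apply: filterS fA => x fAx _; rewrite -EFinM lee_fin absKM normrM.
    rewrite (ger0_norm (absK_ge0 _)) mulrA ler_wpM2r ?absK_ge0//.
    by apply: (le_trans fAx); rewrite ler_wpM2l// ler_norm.
have ifg : integrableK mu (fun x => f x * g x).
  by apply: integrableK_abs => //; apply: le_lt_trans le_fg _; rewrite ltry.
split => //; rewrite -lee_fin; apply: le_trans le_fg; exact: absK_integralK.
Qed.

End Integration.

(** * Functions annihilated by the dual of L^p *)

(** For [y = 0] both sides vanish, which needs [r != 1] since [0 `^ 0 = 1]. *)
Lemma powR_pred_mul (R : realType) (y r : R) : 0 <= y -> r != 1 ->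
  y `^ (r - 2) * y = y `^ (r - 1).
Proof.
move=> y0 r1; have [->|yn0] := eqVneq y 0.
  by rewrite mulr0 powR0// subr_eq0.
rewrite -{2}(powRr1 y0) -powRD ?yn0 ?implybT//.
by congr (_ `^ _); ring.
Qed.

Section DualityLp.
Context d (X : measurableType d) (R : realType) (b : scalar_kind).
Variable mu : {measure set X -> \bar R}.
Variables (p q : R) (p1 : 1 < p) (q1 : 1 < q) (pq : p^-1 + q^-1 = 1).
Implicit Types f g : X -> RorC R b.

Lemma p_integrable_dual0 f : f \in p_integrable mu p ->
  (forall g, g \in p_integrable mu q ->
    integralK mu (fun x => f x * conjK (g x)) = 0) ->
  {ae mu, forall x, f x = 0}.
Proof.
rewrite inE => -[mf foo] fg0; have p0 := lt_trans ltr01 p1.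
have mabs := measurable_absK mf.
(* [g = |f|^(p-2) f] is in L^q, and [f * conj g = |f|^p]. *)
pose c x := absK (f x) `^ (p - 2).
have c0 x : 0 <= c x by exact: powR_ge0.
have mc : measurable_fun setT c.
  exact: (measurableT_comp (measurable_powR _)).
pose g x := mkK b (c x) 0 * f x.
have absg x : absK (g x) = absK (f x) `^ (p - 1).
  by rewrite absKM absK_mk0// powR_pred_mul ?absK_ge0// gt_eqF.
have mg : measurableK g.
  by apply: measurableKM => //; apply: measurableK_mk => //;
     exact: measurable_cst.
(* [p] and [q] are conjugate, so that [|g|^q = |f|^p]. *)
have pqp : (p - 1) * q = p.
  have q0 := lt_trans ltr01 q1.
  have : p * q * (p^-1 + q^-1) = p * q by rewrite pq mulr1.
  rewrite mulrDr mulrAC divff ?gt_eqF// mul1r -mulrA divff ?gt_eqF// mulr1.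
  by move=> pqE; rewrite mulrBl mul1r -pqE addrAC subrr add0r.
have gq : g \in p_integrable mu q.
  rewrite inE; split => //.
  by under eq_integral do rewrite absg -powRrM pqp.
have fgE x : reK (f x * conjK (g x)) = absK (f x) `^ p.
  rewrite /g conjKM mulrCA mulrC reKM imK_conj imK_mk0 oppr0 mulr0 subr0.
  rewrite [f x * _]mulrC reK_conj_mul reK_conj reK_mk mulrC expr2 mulrA.
  rewrite powR_pred_mul ?absK_ge0 ?gt_eqF//.
  have -> : p - 1 = (p + 1) - 2 by ring.
  by rewrite powR_pred_mul ?absK_ge0 ?addrK// gt_eqF// ltrDr.
have mfp : measurable_fun setT (fun x => absK (f x) `^ p).
  exact: (measurableT_comp (measurable_powR _)).
have int0 : (\int[mu]_x (absK (f x) `^ p)%:E = 0)%E.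
  have := congr1 reK (fg0 _ gq); rewrite reK_integralK reK0 /Rintegral.
  under eq_integral do rewrite fgE.
  move=> /eqP; rewrite fine_eq0 => [/eqP//|].
  rewrite ge0_fin_numE//; apply: integral_ge0 => x _.
  by rewrite lee_fin powR_ge0.
have : ae_eq mu setT (fun x => (absK (f x) `^ p)%:E) (cst 0%E).
  apply/ae_eq_integral_abs => //; first exact/measurable_EFinP.
  by under eq_integral do rewrite /= ger0_norm ?powR_ge0//.
apply: filterS => x /(_ I)/= [/eqP]; rewrite powR_eq0 => /andP[/eqP f0 _].
exact: absK_eq0.
Qed.

End DualityLp.

(** * Reproducing kernel Hilbert spaces *)

Section RKHS.
Variables (R : realType) (b : scalar_kind) (X : Type).
Local Notation K := (RorC R b).
Variables (k : X -> X -> K) (Hk : rkhs k).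
Implicit Types (f : Hk) (x : X).

Local Notation dot := (rkhs_dot Hk).
(** The norm of [k(., x)], that is the square root of [k x x]. *)
Local Notation kappa x := (norm_re (rkhs_kernel Hk x)).

Lemma kernel_diagE x : reK (k x x) = kappa x ^+ 2.
Proof.
by rewrite (norm_reE (@rkhs_normE _ _ _ _ Hk)) -rkhs_reproducing rkhs_kernelE.
Qed.

Lemma kappaE x : kappa x = Num.sqrt (reK (k x x)).
Proof. by rewrite kernel_diagE sqrtr_sqr ger0_norm// norm_re_ge0. Qed.

Lemma kernel_conj x y : k x y = conjK (k y x).
Proof.
have kE u v : k u v = dot (rkhs_kernel Hk v) (rkhs_kernel Hk u).
  by rewrite -rkhs_reproducing rkhs_kernelE.
by rewrite !kE [LHS]dotC.
Qed.

Lemma absK_rkhs_fun_le f x : absK (rkhs_fun Hk f x) <= norm_re f * kappa x.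
Proof.
by rewrite rkhs_reproducing absK_dot_le//; exact: rkhs_normE.
Qed.

End RKHS.

Section RKHSMeasure.
Context d (X : measurableType d) (R : realType) (b : scalar_kind).
Local Notation K := (RorC R b).
Variables (k : X -> X -> K) (Hk : rkhs k).
Hypothesis k_meas : measurableK (fun z : X * X => k z.1 z.2).
Local Notation dot := (rkhs_dot Hk).
Local Notation kappa x := (norm_re (rkhs_kernel Hk x)).
Implicit Types (f : Hk) (x : X).

Lemma measurable_kernel_section x : measurableK (k^~ x).
Proof.
case: k_meas => mr mi.
split; first exact: (measurable_fun_pair1 x mr).
exact: (measurable_fun_pair1 x mi).
Qed.

Lemma measurable_kappa : measurable_fun setT (fun x => kappa x).
Proof.
under eq_fun do rewrite kappaE.
apply: measurableT_comp.
  by apply: continuous_measurable_fun; exact: sqrt_continuous.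
case: k_meas => mr _.
apply: (@measurableT_comp _ _ _ _ _ _ _ _ (fun x : X => (x, x)) mr).
exact: measurable_fun_pair.
Qed.

(** The vectors whose function is measurable form a subspace containing every
[k(., x)], hence approximating every [f]; norm convergence is pointwise
convergence. *)
Lemma measurable_rkhs_fun f : measurableK (rkhs_fun Hk f).
Proof.
have [||u uV|v_ v_V v_f] := @orthogonal_trivial_approx R b Hk dot
    (@rkhs_normE _ _ _ _ Hk) [set u | measurableK (rkhs_fun Hk u)] _ _ _ f.
- by rewrite /= linear0; split; case: (b) => /=; exact: measurable_cst.
- by move=> a u v /= mu mv; rewrite linearP; exact: measurableK_scaleD.
- apply: (@rkhs_fun_inj _ _ _ _ Hk); rewrite linear0; apply/funext => x.
  rewrite rkhs_reproducing dotC uV ?conjK0//=.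
  by rewrite rkhs_kernelE; exact: measurable_kernel_section.
have cvgx (x : X) :
    absK (rkhs_fun Hk (v_ n) x - rkhs_fun Hk f x) @[n --> \oo] --> 0.
  apply: (@squeeze_cvgr _ _ _ _ (fun=> 0)
    (fun n => norm_re (v_ n - f) * kappa x)).
  - apply: nearW => n; rewrite absK_ge0/=.
    rewrite (_ : _ - _ = rkhs_fun Hk (v_ n - f) x) ?absK_rkhs_fun_le//.
    by rewrite linearB.
  - exact: cvg_cst.
  - by rewrite -[0 in X in _ --> X](mul0r (kappa x)); apply: cvgM => //;
       exact: cvg_cst.
have cvg_part (part : K -> R) : (forall z w, part (z - w) = part z - part w) ->
    (forall z, `|part z| <= absK z) ->
    forall x, part (rkhs_fun Hk (v_ n) x) @[n --> \oo] -->
      part (rkhs_fun Hk f x).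
  move=> partB part_le x; apply/cvgrPdist_le => e e0.
  move/cvgrPdist_le : (cvgx x) => /(_ e e0); apply: filterS => n.
  rewrite sub0r normrN (ger0_norm (absK_ge0 _)); apply: le_trans.
  by rewrite distrC -partB.
split.
- apply: (@measurable_fun_cvg _ _ _ _ (fun n => reK \o rkhs_fun Hk (v_ n))).
    by move=> n; have [] := v_V n.
  move=> x _; apply: cvg_part => [z w|z]; last exact: reK_le_abs.
  by rewrite reKD reKN.
- apply: (@measurable_fun_cvg _ _ _ _ (fun n => imK \o rkhs_fun Hk (v_ n))).
    by move=> n; have [] := v_V n.
  move=> x _; apply: cvg_part => [z w|z]; last exact: imK_le_abs.
  by rewrite imKD imKN.
Qed.

Variables (mu : {measure set X -> \bar R}) (p q : R).
Hypotheses (p1 : 1 < p) (q1 : 1 < q) (pq : p^-1 + q^-1 = 1).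
Hypothesis k_Lp : (kernel_Lnorm mu p k < +oo)%E.

Let p0 : 0 < p. Proof. exact: lt_trans p1. Qed.
Let q0 : 0 < q. Proof. exact: lt_trans q1. Qed.

(** This is the finiteness of [kernel_Lnorm], as [kappa x ^ p] is
[k x x ^ (p / 2)]. *)
Lemma kappa_Lfun : (fun x => kappa x) \in Lfun mu p%:E.
Proof.
rewrite inE; apply/andP; split; first by rewrite inE; exact: measurable_kappa.
rewrite inE/= /finite_norm unlock.
apply: le_lt_trans k_Lp; rewrite /kernel_Lnorm.
rewrite le_eqVlt; apply/orP; left; apply/eqP; congr (_ `^ _)%E.
apply: eq_integral => x _ /=; rewrite ger0_norm ?norm_re_ge0// kappaE.
by rewrite -powR12_sqrt ?(kernel_diagE Hk) ?sqr_ge0// -powRrM mulrC.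
Qed.

Lemma rkhs_p_integrable f : rkhs_fun Hk f \in p_integrable mu p.
Proof.
rewrite inE; split; first exact: measurable_rkhs_fun.
apply: (@le_lt_trans _ _
  (\int[mu]_x ((norm_re f `^ p)%:E * `|(`|kappa x| `^ p)%:E|))%E).
  apply: ge0_le_integral => //=.
  - by move=> x _; rewrite lee_fin powR_ge0.
  - apply/measurable_EFinP/(measurableT_comp (measurable_powR _)).
    exact/measurable_absK/measurable_rkhs_fun.
  - apply/measurable_EFinP/measurable_funM => //; apply: measurableT_comp => //.
    apply: (measurableT_comp (measurable_powR _)).
    apply: measurableT_comp => //.
    exact: measurable_kappa.
  - move=> x _; rewrite -EFinM lee_fin ger0_norm ?powR_ge0//.
    rewrite ger0_norm ?norm_re_ge0// -powRM ?norm_re_ge0//.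
    by rewrite ge0_ler_powR ?nnegrE ?absK_ge0 ?mulr_ge0 ?norm_re_ge0
      ?absK_rkhs_fun_le// ltW.
have /integrableP[mkap kap] := Lfun_integrable (ltW p1) kappa_Lfun.
rewrite ge0_integralZl_EFin ?powR_ge0//=; last first.
  by move/measurable_EFinP : mkap => mkap;
     apply/measurable_EFinP/measurableT_comp.
by apply: lte_mul_pinfty; rewrite ?lee_fin ?powR_ge0//.
Qed.

(** The L^p norm of the square root of the diagonal of [k], as a real number;
it bounds the norm of the integral operator. *)
Definition kernel_Lp_bound : R := fine 'N[mu]_p%:E[EFin \o (fun x => kappa x)].

(** The pairing of [Hk] with L^q is well defined and continuous. *)
Lemma rkhs_pairing f (g : X -> K) : g \in p_integrable mu q ->
  integrableK mu (fun x => rkhs_fun Hk f x * g x) /\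
  absK (integralK mu (fun x => rkhs_fun Hk f x * g x)) <=
    norm_re f * (kernel_Lp_bound * fine 'N[mu]_q%:E[EFin \o (@absK R b \o g)]).
Proof.
move=> gq; apply: integralK_hoelder => //.
- exact: norm_re_ge0.
- exact: measurable_rkhs_fun.
- exact: kappa_Lfun.
- by apply: nearW => x; exact: absK_rkhs_fun_le.
Qed.

Lemma p_integrable_conj (g : X -> K) : g \in p_integrable mu q ->
  (fun x => conjK (g x)) \in p_integrable mu q.
Proof.
rewrite !inE => -[mg goo]; split; first exact: measurableK_conj.
by under eq_integral do rewrite absK_conj.
Qed.

(** The value of the integral operator at [g], as a Riesz representer. *)
Lemma kernel_operator_exists (g : X -> K) : g \in p_integrable mu q ->
  exists h : Hk, forall f,
    dot f h = integralK mu (fun x => rkhs_fun Hk f x * conjK (g x)).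
Proof.
move=> gq; have gq' := p_integrable_conj gq.
pose phi f := integralK mu (fun x => rkhs_fun Hk f x * conjK (g x)).
have [||||h [_ [_ _ hE]]] := @riesz_on_subspace R b Hk dot
    (@rkhs_normE _ _ _ _ Hk) setT phi
    (kernel_Lp_bound *
     fine 'N[mu]_q%:E[EFin \o (@absK R b \o (fun x => conjK (g x)))]) => //.
- move=> a u v _ _; rewrite /phi -integralK_linear;
    [|exact: (rkhs_pairing _ gq').1..].
  congr integralK; apply/funext => x.
  by rewrite linearP mulrDl -mulrA.
- by move=> v _; rewrite mulrC; exact: (rkhs_pairing _ gq').2.
by exists h => f; rewrite -hE.
Qed.

Lemma kernel_integrable (g : X -> K) x : g \in p_integrable mu q ->
  integrableK mu (fun x' => k x x' * g x').
Proof.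
move=> gq.
have := integrableK_conj
  (rkhs_pairing (rkhs_kernel Hk x) (p_integrable_conj gq)).1.
rewrite rkhs_kernelE; congr integrableK; apply/funext => x'.
by rewrite conjKM conjKK -(kernel_conj Hk).
Qed.

(** Consequences of being the Riesz representer of the pairing with [g]. *)
Section KernelOperator.
Variables (g : X -> K) (h : Hk).
Hypothesis gq : g \in p_integrable mu q.
Hypothesis hE : forall f,
  dot f h = integralK mu (fun x => rkhs_fun Hk f x * conjK (g x)).

Lemma kernel_operatorE x :
  rkhs_fun Hk h x = integralK mu (fun x' => k x x' * g x').
Proof.
rewrite rkhs_reproducing dotC hE rkhs_kernelE -integralK_conj.
  congr integralK; apply/funext => x'.
  by rewrite conjKM conjKK -(kernel_conj Hk).
have := (rkhs_pairing (rkhs_kernel Hk x) (p_integrable_conj gq)).1.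
by rewrite rkhs_kernelE.
Qed.

Lemma kernel_operator_norm_le :
  norm_re h <= kernel_Lp_bound * fine 'N[mu]_q%:E[EFin \o (@absK R b \o g)].
Proof.
have Ng0 : 0 <= kernel_Lp_bound * fine 'N[mu]_q%:E[EFin \o (@absK R b \o g)].
  by rewrite mulr_ge0// fine_ge0// Lnorm_ge0.
have [->//|h0] := eqVneq (norm_re h) 0.
have h_gt0 : 0 < norm_re h by rewrite lt0r h0 norm_re_ge0.
rewrite -(ler_pM2l h_gt0) -expr2 (norm_reE (@rkhs_normE _ _ _ _ Hk)) hE.
have [_] := rkhs_pairing h (p_integrable_conj gq).
rewrite (_ : _ \o (fun x => conjK (g x)) = @absK R b \o g); last first.
  by apply/funext => x /=; rewrite absK_conj.
by apply: le_trans; apply: le_trans (ler_norm _) (reK_le_abs _).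
Qed.

End KernelOperator.

End RKHSMeasure.

(** * The integral operator of a kernel on L^q *)

Theorem proposition5p4 (R : realType) (b : scalar_kind) (d : measure_display)
    (X : metricMeasurableType d R) (mu : {sigma_finite_measure set X -> \bar R})
    (p q : R) (p1 : 1 < p) (q1 : 1 < q) (pq : p^-1 + q^-1 = 1)
    (k : X -> X -> RorC R b)
    (k_psd : psd_kernel k)
    (k_meas : measurableK (fun z : X * X => k z.1 z.2))
    (Hk : rkhs k) (Hk_sep : separable_space Hk)
    (k_Lp : (kernel_Lnorm mu p k < +oo)%E)
    (alpha : R) (alpha_gt0 : 0 < alpha)
    (La : X -> R) (La_ge0 : forall x, 0 <= La x) (La_Lp : La \in Lfun mu p%:E)
    (k_holder : {ae mu, forall x, holder_continuous alpha (La x) (k^~ x)}) :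
  (exists S : {linear LpK b mu (ltW q1) -> Hk},
    [/\ forall (g : calLp b mu (ltW q1)) (x : X),
          integrableK mu (fun x' => k x x' * g x') /\
          rkhs_fun Hk (S (LpK_class g)) x = integralK mu (fun x' => k x x' * g x'),
        exists C : R, forall g, reK `|S g| <= C * LpK_norm g,
        forall g, holder_continuous alpha
          (fine ('N[mu]_p%:E[EFin \o La]) * LpK_norm g) (rkhs_fun Hk (S g)) &
        exists Hp : forall f : Hk, rkhs_fun Hk f \in p_integrable mu p,
          injective (rkhs_id (ltW p1) Hp) -> dense (range S)]).
Proof.
have p0 := lt_trans ltr01 p1; have q0 := lt_trans ltr01 q1.
have gP (g : calLp b mu (ltW q1)) : (g : X -> _) \in p_integrable mu q.
  exact: calLpP.
have mg (g : calLp b mu (ltW q1)) : measurableK g.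
  by have := gP g; rewrite inE => -[].
have ik (g : calLp b mu (ltW q1)) x : integrableK mu (fun x' => k x x' * g x').
  exact: (kernel_integrable Hk k_meas p1 q1 pq k_Lp).
(* The operator is defined on a class through its chosen representative; the
   integral formula shows that the choice is irrelevant. *)
have [S0 S0P] := choice (fun u : LpK b mu (ltW q1) =>
  kernel_operator_exists Hk k_meas p1 q1 pq k_Lp (gP (repr u))).
have piE (u : LpK b mu (ltW q1)) : LpK_class (repr u) = u by exact: reprK.
have S0E g x : rkhs_fun Hk (S0 (LpK_class g)) x =
    integralK mu (fun x' => k x x' * g x').
  rewrite (kernel_operatorE k_meas p1 q1 pq k_Lp (gP _) (S0P _)).
  apply: ae_eq_integralK; [exact: integrableK_measurable..|].
  have /LpK_classP := piE (LpK_class g).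
  by apply: filterS => x' ->.
have S0lin : linear S0.
  move=> a u v; apply: (@rkhs_fun_inj _ _ _ _ Hk); rewrite linearP.
  rewrite -[u]piE -[v]piE -[a *: LpK_class _]/(LpK_scale a _) LpK_classZ.
  rewrite -LpK_classD.
  apply/funext => x.
  rewrite -[RHS]/(a * rkhs_fun Hk (S0 _) x + rkhs_fun Hk (S0 _) x) !S0E.
  rewrite -integralK_linear//.
  congr integralK; apply/funext => x' /=.
  by rewrite -[(_ + _) x']/(a * _ + _) mulrDr mulrCA.
pose SL := GRing.isLinear.Build _ _ _ _ S0 S0lin.
pose S : {linear LpK b mu (ltW q1) -> Hk} := HB.pack S0 SL.
exists S; split.
- by move=> g x; split; [exact: ik|exact: S0E].
- exists (kernel_Lp_bound Hk mu p) => u.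
  exact: (kernel_operator_norm_le k_meas p1 q1 pq k_Lp (gP _) (S0P _)).
- move=> u x y; rewrite -[u]piE; set g := repr u.
  rewrite -[S _]/(S0 _) !S0E LpK_normE.
  have -> : integralK mu (fun x' => k x x' * g x') -
      integralK mu (fun x' => k y x' * g x') =
      integralK mu (fun x' => (k x x' - k y x') * g x').
    rewrite addrC -mulN1r -integralK_linear//; congr integralK.
    by apply/funext => x'; rewrite mulN1r addrC mulrBl.
  rewrite mulrC.
  apply: (integralK_hoelder p0 q0 (powR_ge0 _ _) pq _ La_Lp _ (gP g)).2.
    have mk z : measurableK (fun x' => k z x').
      rewrite (_ : k z = fun x' => conjK (k x' z)).
        exact: measurableK_conj (measurable_kernel_section k_meas z).
      by apply/funext => x'; exact: (kernel_conj Hk).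
    rewrite (_ : (fun x' => _) = (-1 : RorC R b) *: k y + k x).
      exact: measurableK_scaleD.
    by apply/funext => x'; rewrite addrC -[RHS]/(-1 * k y x' + k x x') mulN1r.
  by apply: filterS k_holder => x' /(_ x y); rewrite mulrC.
- exists (rkhs_p_integrable k_meas p1 k_Lp) => id_inj.
  apply: (@orthogonal_trivial_dense _ _ _ (rkhs_dot Hk)
    (@rkhs_normE _ _ _ _ Hk)).
  + by exists 0 => //; rewrite linear0.
  + by move=> a _ _ [u _ <-] [v _ <-]; exists (a *: u + v) => //;
       rewrite linearP.
  + move=> f f_perp; apply: id_inj; apply/LpK_classP => /=.
    rewrite linear0.
    apply: (p_integrable_dual0 p1 q1 pq (rkhs_p_integrable k_meas p1 k_Lp f)).
    move=> g gq.
    have [h hE] := kernel_operator_exists Hk k_meas p1 q1 pq k_Lp gq.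
    rewrite -hE dotC.
    have -> : h = S (LpK_class (MkCalLp (ltW q1) gq)).
      apply: (@rkhs_fun_inj _ _ _ _ Hk); apply/funext => x.
      by rewrite -[S _]/(S0 _) S0E
           (kernel_operatorE k_meas p1 q1 pq k_Lp gq hE).
    by rewrite f_perp ?conjK0//; exists (LpK_class (MkCalLp (ltW q1) gq)).
Qed.
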